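(* Let $n\ge 1$ and let $E_n$ be the number of alternating permutations of $\{1,\dots,n\}$. Let $\sigma_1,\dots,\sigma_{E_n}$ be an ordering of all the alternating permutations of $\{1,\dots,n\}$ such that if $i<j$ then $\mathrm{inv}(\sigma_i)\ge \mathrm{inv}(\sigma_j)$. Then the ordering $\Delta^{\sigma_1},\dots,\Delta^{\sigma_{E_n}}$ of the simplices of the canonical triangulation of the order polytope $\mathcal{O}(\mathcal{Z}_n)$ is a shelling order.
   Context: The zig-zag poset $\mathcal{Z}_n$ on ground set $\{z_1,\dots,z_n\}$ is the poset with exactly the cover relations $z_1 < z_2 > z_3 < z_4 > \cdots$. Its order polytope $\mathcal{O}(\mathcal{Z}_n)$ is the set of all $(x_1,\dots,x_n)\in\mathbb{R}^n$ with $0\le x_i\le 1$ for all $i$ and $x_i\le x_j$ whenever $z_i<z_j$ in $\mathcal{Z}_n$. An alternating permutation on $n$ letters is a permutation $\sigma$ of $\{1,\dots,n\}$ with $\sigma(1)<\sigma(2)>\sigma(3)<\sigma(4)>\cdots$. These are exactly the linear extensions of $\mathcal{Z}_n$ (identifying $z_i$ with $i$). The inversion number $\mathrm{inv}(\sigma)$ is the number of pairs $i<j$ with $\sigma(i)>\sigma(j)$. For an alternating permutation $\sigma$, define $\mathbf{v}_0^\sigma=(1,\dots,1)\in\mathbb{R}^n$ and $\mathbf{v}_i^\sigma=\mathbf{v}_{i-1}^\sigma-\mathbf{e}_{\sigma^{-1}(i)}$ for $1\le i\le n$, where $\mathbf{e}_j$ is the $j$th standard basis vector. Let $\Delta^\sigma$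 be the convex hull of $\mathbf{v}_0^\sigma,\dots,\mathbf{v}_n^\sigma$, an $n$-dimensional simplex. The simplices $\Delta^\sigma$, with $\sigma$ ranging over all alternating permutations, are the maximal simplices of the canonical (unimodular) triangulation of $\mathcal{O}(\mathcal{Z}_n)$. An ordering $\Delta_1,\dots,\Delta_s$ of the maximal simplices of a pure simplicial complex is a shelling order if for all $1<r\le s$, the set $\bigcup_{i=1}^{r-1}(\Delta_i\cap\Delta_r)$ is a union of facets of $\Delta_r$. Equivalently: for all $r\le s$ and $k<r$ there exists $i<r$ such that $\Delta_k\cap\Delta_r\subset\Delta_i\cap\Delta_r$ and $\Delta_i\cap\Delta_r$ is a facet of $\Delta_r$. *)

(* Defs.v *)
From mathcomp Require Import all_boot all_order all_algebra.
From mathcomp Require Import all_fingroup.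
From mathcomp Require Import boolp classical_sets reals.
Set Implicit Arguments.
Unset Strict Implicit.
Unset Printing Implicit Defensive.
Import Order.TTheory GRing.Theory Num.Theory.
Local Open Scope classical_set_scope.
Local Open Scope ring_scope.

Section Complexes.
Variables (R : realType) (n : nat).
Local Notation V := 'rV[R]_n.

Definition conv_hull (I : finType) (v : I -> V) (A : {set I}) : set V :=
  [set x | exists w : I -> R,
     [/\ forall i, i \in A -> 0 <= w i,
         \sum_(i in A) w i = 1
       & x = \sum_(i in A) w i *: v i]].

Definition affinely_independent (I : finType) (v : I -> V) : Prop :=
  forall c : I -> R,
    \sum_i c i = 0 -> \sum_i c i *: v i = 0 -> forall i, c i = 0.

(* [v] lists the k vertices of the (k-1)-dimensional simplex [S]; the empty
   set is the simplex with k = 0 vertices. *)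
Definition simplex_vertices (k : nat) (S : set V) (v : 'I_k -> V) : Prop :=
  affinely_independent v /\ S = conv_hull v [set: 'I_k]%SET.

Definition is_simplex (k : nat) (S : set V) : Prop :=
  exists v : 'I_k -> V, simplex_vertices S v.

(* The empty set and S itself are faces of a simplex S. *)
Definition is_face (F S : set V) : Prop :=
  exists (k : nat) (v : 'I_k -> V) (A : {set 'I_k}),
    simplex_vertices S v /\ F = conv_hull v A.

Definition is_facet (F S : set V) : Prop :=
  exists (k : nat) (v : 'I_k -> V) (i : 'I_k),
    simplex_vertices S v /\ F = conv_hull v [set~ i]%SET.

Definition simplicial_complex (K : set (set V)) : Prop :=
  [/\ forall S, K S -> exists k, is_simplex k S,
      forall S F, K S -> is_face F S -> K F
    & forall S T, K S -> K T -> is_face (S `&` T) S /\ is_face (S `&` T) T].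

Definition maximal_simplex (K : set (set V)) (S : set V) : Prop :=
  K S /\ forall T, K T -> S `<=` T -> T = S.

Definition pure (K : set (set V)) : Prop :=
  exists k, forall S, maximal_simplex K S -> is_simplex k S.

Definition triangulates (K : set (set V)) (P : set V) : Prop :=
  simplicial_complex K /\ \bigcup_(S in K) S = P.

(* A union of facets is a union of at least one facet: this is what makes the
   condition equivalent to "for all k < r there is i < r such that D k `&` D r
   is contained in D i `&` D r and D i `&` D r is a facet of D r", also when
   D k `&` D r is empty. *)
Definition shelling_order (K : set (set V)) (s : nat) (D : 'I_s -> set V)
    : Prop :=
  [/\ simplicial_complex K, pure K,
      injective D, range D = maximal_simplex K
    & forall r : 'I_s, (0 < r)%N ->
        exists Fs : set (set V),
          [/\ Fs !=set0, forall F, Fs F -> is_facet F (D r)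
            & \bigcup_(i in [set i : 'I_s | (i < r)%N]) (D i `&` D r)
              = \bigcup_(F in Fs) F]].

End Complexes.

(* Everything below is 0-based: the ordinal i : 'I_n stands for the element
   z_{i+1}, the position i+1 or the letter i+1. *)

(* The strict order of the zig-zag poset: no two of the cover relations
   z_1 < z_2 > z_3 < ... compose, so they form the whole strict order. *)
Definition zigzag_lt (n : nat) (i j : 'I_n) : bool :=
  ~~ odd i && ((j == i.+1 :> nat) || (i == j.+1 :> nat)).

Definition order_polytope (R : realType) (n : nat) (lt : rel 'I_n)
    : set 'rV[R]_n :=
  [set x : 'rV[R]_n | (forall i, 0 <= x 0 i <= 1) /\
                     (forall i j, lt i j -> x 0 i <= x 0 j)].
Arguments order_polytope R {n} lt.

Definition alternating (n : nat) (sigma : 'S_n) : bool :=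
  [forall i : 'I_n, forall j : 'I_n, (j == i.+1 :> nat) ==>
     (if odd i then (sigma j < sigma i)%N else (sigma i < sigma j)%N)].

Definition num_alternating (n : nat) : nat :=
  #|[set sigma : 'S_n | alternating sigma]%SET|.

Definition inv_number (n : nat) (sigma : 'S_n) : nat :=
  #|[set p : 'I_n * 'I_n | (p.1 < p.2)%N && (sigma p.2 < sigma p.1)%N]%SET|.

(* The recursion v_0 = (1,...,1), v_i = v_{i-1} - e_{sigma^-1(i)}, unrolled:
   the letters 1, ..., i are the ordinals k < i. *)
Definition chain_vertex (R : realType) (n : nat) (sigma : 'S_n)
    (i : 'I_n.+1) : 'rV[R]_n :=
  const_mx 1 - \sum_(k < n | (k < i)%N) delta_mx 0 (sigma^-1%g k).

Definition chain_simplex (R : realType) (n : nat) (sigma : 'S_n)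
    : set 'rV[R]_n :=
  conv_hull (chain_vertex R sigma) [set: 'I_n.+1]%SET.
Arguments chain_simplex R {n} sigma.

Definition canonical_triangulation (R : realType) (n : nat)
    : set (set 'rV[R]_n) :=
  [set F | exists2 sigma : 'S_n,
             alternating sigma & is_face F (chain_simplex R sigma)].
Arguments canonical_triangulation R n : clear implicits.

(* Main.v *)
Require Import Defs.
From mathcomp Require Import all_boot all_order all_algebra.
From mathcomp Require Import all_fingroup.
From mathcomp Require Import boolp classical_sets reals.
From mathcomp Require Import zify lra.
Set Implicit Arguments.
Unset Strict Implicit.
Unset Printing Implicit Defensive.

(** The simplex of an alternating permutation s consists of the points of the
    unit cube whose coordinates increase with the letters of s
    ([chain_simplexP]). That these simplices and their faces triangulate the
    order polytope then comes from comparing inequalities: every point of the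
    polytope lies in the simplex of a permutation sorting its coordinates
    ([canonical_cover]), and two simplices meet in a face of each because
    conflicting inequalities only force coordinates to be equal
    ([chain_simplexI_extreme]). Faces of a simplex are handled throughout as its
    convex extreme subsets ([is_faceP]), which makes being a face transitive
    and compatible with intersections.

    For the shelling, let t precede s in the ordering, so that t has at least
    as many inversions as s. Some pair of positions p < q is then an inversion
    of t but not of s ([exists_new_inversion]); p and q are not adjacent, since
    alternation fixes the order of neighbouring entries. Walking through the
    letters of s from s(p) to s(q), one must at some point jump from a position
    a to a position b > a + 1 holding the next letter ([exists_swappable]).
    Exchanging these two letters gives an alternating permutation with more
    inversions than s, which hence precedes s, and whose simplex meets that of
    s in the facet x_a = x_b ([swap_simplexI], [swap_facet]). This facet
    contains the intersection of the simplices of t and s, because there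
    x_p <= x_a <= x_b <= x_q by s, while x_q <= x_p by t. *)

(** * Faces of a simplex as convex extreme subsets *)

Section Faces.
Local Open Scope classical_set_scope.
Local Open Scope ring_scope.
Import Order.TTheory GRing.Theory Num.Theory.
Variables (R : realType) (n : nat).
Local Notation V := 'rV[R]_n.
Implicit Types (F S T : set V) (x y : V) (t : R).

(** For a simplex these are exactly the faces ([is_faceP]). Working with them
    avoids any choice of a vertex list: whether two listings of the vertices
    of one simplex agree never has to be discussed. *)
Definition extreme_subset F S : Prop :=
  [/\ F `<=` S,
      forall x y t, F x -> F y -> 0 <= t <= 1 -> F (t *: x + (1 - t) *: y)
    & forall x y t, S x -> S y -> 0 < t < 1 ->
        F (t *: x + (1 - t) *: y) -> F x].

Lemma extreme_subset_both F S x y t : extreme_subset F S -> S x -> S y ->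
  0 < t < 1 -> F (t *: x + (1 - t) *: y) -> F x /\ F y.
Proof.
move=> [_ _ F_ext] Sx Sy /[dup] t01 /andP[t0 t1] Fz.
split; first exact: F_ext Fz.
apply: (F_ext y x (1 - t)) => //; first by apply/andP; split; lra.
by rewrite addrC opprB addrCA subrr addr0.
Qed.

Lemma extreme_subset_trans F S T :
  extreme_subset F S -> extreme_subset S T -> extreme_subset F T.
Proof.
move=> [sFS F_conv F_ext] ST; have [sST _ _] := ST.
split=> [|//|x y t Tx Ty t01 Fz]; first exact: subset_trans sFS sST.
have [Sx Sy] := extreme_subset_both ST Tx Ty t01 (sFS _ Fz).
exact: F_ext Fz.
Qed.

(** Faces of two simplices meet in a common face as soon as the two ambient
    simplices do; so only maximal simplices have to be intersected. *)
Lemma extreme_subsetI F G S T :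
    extreme_subset F S -> extreme_subset G T -> extreme_subset (S `&` T) S ->
  extreme_subset (F `&` G) F.
Proof.
move=> [sFS F_conv _] GT ST; have [sGT G_conv G_ext] := GT.
split=> [x []//|x y t [Fx Gx] [Fy Gy] t01|x y t Fx Fy t01 [Fz Gz]].
  by split; [apply: F_conv | apply: G_conv].
split=> //; have [[_ Tx] [_ Ty]] := extreme_subset_both ST (sFS _ Fx) (sFS _ Fy)
  t01 (conj (sFS _ Fz) (sGT _ Gz)).
exact: G_ext Gz.
Qed.

Lemma sum_support {I : finType} {W : nmodType} (g : I -> W) (A B : {set I}) :
  A \subset B -> {in B, forall i, i \notin A -> g i = 0} ->
  \sum_(i in B) g i = \sum_(i in A) g i.
Proof.
move=> sAB g0; rewrite (big_setID A) /= (finset.setIidPr sAB).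
by rewrite [X in _ + X]big1 ?addr0 // => i /finset.setDP[/g0].
Qed.

Lemma conv_hull_support {I : finType} (v : I -> V) (A B : {set I}) w :
    A \subset B -> {in B, forall i, 0 <= w i} -> \sum_(i in B) w i = 1 ->
    {in B, forall i, i \notin A -> w i = 0} ->
  conv_hull v A (\sum_(i in B) w i *: v i).
Proof.
move=> sAB w_ge0 w_sum w0; exists w; split.
- by move=> i /(fintype.subsetP sAB)/w_ge0.
- by rewrite -w_sum (sum_support sAB).
- by rewrite (sum_support sAB) // => i Bi Ai; rewrite w0 ?scale0r.
Qed.

Lemma conv_hullS {I : finType} (v : I -> V) (A B : {set I}) :
  A \subset B -> conv_hull v A `<=` conv_hull v B.
Proof.
move=> sAB x [w [w_ge0 w_sum ->]].
pose u i := if i \in A then w i else 0.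
have uE : {in A, w =1 u} by move=> i Ai; rewrite /u Ai.
have u0 i : i \notin A -> u i = 0 by move=> /negPf Ai; rewrite /u Ai.
exists u; split.
- by move=> i _; rewrite /u; case: ifP => // /w_ge0.
- rewrite -w_sum (sum_support sAB) => [|i _ /u0//].
  by apply: eq_bigr => i /uE.
- rewrite (sum_support sAB) => [|i _ /u0->]; last exact: scale0r.
  by apply: eq_bigr => i /uE ->.
Qed.

(** Isolating one vertex turns a convex combination into a segment from that
    vertex to a point of the hull of the others. This is the step that brings
    many-point combinations down to the two-point conditions of
    [extreme_subset]. *)
Lemma conv_hull_split {I : finType} (v : I -> V) {A : {set I}} {w : I -> R} i :
    (forall j, j \in A -> 0 <= w j) -> \sum_(j in A) w j = 1 -> i \in A ->
  \sum_(j in A) w j *: v j = v i \/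
  exists2 y, conv_hull v (A :\ i)%SET y &
    w i < 1 /\ \sum_(j in A) w j *: v j = w i *: v i + (1 - w i) *: y.
Proof.
move=> w_ge0 w_sum Ai; rewrite (big_setD1 i) //=.
have rest : \sum_(j in A :\ i) w j = 1 - w i.
  by rewrite -w_sum (big_setD1 i Ai) /= addrC addrK.
have w_ge0' j : j \in A :\ i -> 0 <= w j by case/finset.setD1P=> _ /w_ge0.
have : w i <= 1 by rewrite -subr_ge0 -rest sumr_ge0.
rewrite le_eqVlt => /predU1P[wi1|wi_lt1]; [left|right].
  have /psumr_eq0P w0 : \sum_(j in A :\ i) w j = 0 by rewrite rest wi1 subrr.
  by rewrite wi1 scale1r big1 ?addr0 // => j Aj; rewrite w0 ?scale0r.
have d_gt0 : 0 < 1 - w i by rewrite subr_gt0.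
exists (\sum_(j in A :\ i) (w j / (1 - w i)) *: v j).
  exists (fun j => w j / (1 - w i)); split=> //.
    by move=> j /w_ge0' ?; rewrite divr_ge0 // ltW.
  by rewrite -mulr_suml rest divff ?gt_eqF.
split=> //; congr (_ + _); rewrite scaler_sumr; apply: eq_bigr => j _.
by rewrite scalerA mulrC divfK ?gt_eqF.
Qed.

Lemma conv_hull_min {I : finType} (v : I -> V) (A : {set I}) F :
    (forall x y t, F x -> F y -> 0 <= t <= 1 -> F (t *: x + (1 - t) *: y)) ->
  (forall i, i \in A -> F (v i)) -> conv_hull v A `<=` F.
Proof.
move=> F_conv; have [m] := ubnP #|A|; elim: m => // m IHm in A *.
move=> /[!ltnS] leAm FA x [w [w_ge0 w_sum ->]].
have [A0|[i Ai]] := finset.set_0Vmem A.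
  by move/eqP: w_sum; rewrite A0 big_set0 eq_sym oner_eq0.
case: (conv_hull_split v w_ge0 w_sum Ai) => [->|[y hull_y [/ltW wi1 ->]]].
  exact: FA.
apply: F_conv; [exact: FA | | by rewrite w_ge0].
apply: IHm hull_y; first by rewrite (cardsD1 i) Ai in leAm.
by move=> j /finset.setD1P[_]; apply: FA.
Qed.

Lemma conv_hull_convex {I : finType} (v : I -> V) (A : {set I}) x y t :
  conv_hull v A x -> conv_hull v A y -> 0 <= t <= 1 ->
  conv_hull v A (t *: x + (1 - t) *: y).
Proof.
move=> [w [w_ge0 w_sum ->]] [u [u_ge0 u_sum ->]] /andP[t0 t1].
exists (fun i => t * w i + (1 - t) * u i); split.
- by move=> i Ai; apply: addr_ge0; apply: mulr_ge0; rewrite ?subr_ge0 ?w_ge0 ?u_ge0.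
- by rewrite big_split /= -!mulr_sumr w_sum u_sum !mulr1 addrC subrK.
- rewrite !scaler_sumr -big_split; apply: eq_bigr => i _ /=.
  by rewrite !scalerA -scalerDl.
Qed.

Lemma conv_hullT_inj {I : finType} (v : I -> V) (w u : I -> R) :
  affinely_independent v -> \sum_i w i = \sum_i u i ->
  \sum_i w i *: v i = \sum_i u i *: v i -> w =1 u.
Proof.
move=> v_free sum_eq pt_eq i; apply/eqP; rewrite -subr_eq0; apply/eqP.
apply: (v_free (fun i => w i - u i)); first by rewrite sumrB sum_eq subrr.
by under eq_bigr do rewrite scalerBl; rewrite sumrB pt_eq subrr.
Qed.

(** By affine independence the weights of a point are unique, so if a point of
    an open segment has no weight outside [A], the nonnegative weights of the
    end points outside [A] must vanish too. *)
Lemma conv_hull_extreme {I : finType} (v : I -> V) (A : {set I}) :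
  affinely_independent v ->
  extreme_subset (conv_hull v A) (conv_hull v [set: I]%SET).
Proof.
move=> v_free; split; [exact/conv_hullS/finset.subsetT | exact: conv_hull_convex |].
move=> x y t [w [w_ge0 w_sum ->]] [u [u_ge0 u_sum ->]] /andP[t0 t1].
move=> /[dup] zA [z [z_ge0 z_sum z_pt]].
have big_setT (W : nmodType) (f : I -> W) :
    \sum_(i in [set: I]%SET) f i = \sum_i f i.
  by apply: eq_bigl => i; rewrite inE.
rewrite !big_setT in w_sum u_sum z_pt *.
pose zA' i := if i \in A then z i else 0.
have zE : (fun i => t * w i + (1 - t) * u i) =1 zA'.
  apply: (conv_hullT_inj (v := v)) => //.
    rewrite big_split /= -!mulr_sumr w_sum u_sum !mulr1 addrC subrK.
    by rewrite -z_sum big_mkcond.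
  under eq_bigr do rewrite scalerDl -!scalerA.
  rewrite big_split /= -!scaler_sumr z_pt big_mkcond /=; apply: eq_bigr => i _.
  by rewrite /zA'; case: ifP; rewrite ?scale0r.
have w0 i : i \notin A -> w i = 0.
  move=> nAi; have := zE i; rewrite /zA' (negPf nAi).
  have := w_ge0 i (finset.in_setT i); have := u_ge0 i (finset.in_setT i); nra.
by rewrite -big_setT; apply: conv_hull_support => // [|i _ /w0//];
  rewrite ?big_setT.
Qed.

(** The set [A] consists of the vertices lying in [F]. A vertex with positive
    weight in a point of [F] is an end point of a segment through that point,
    hence lies in [F]; so points of [F] have weights supported in [A]. *)
Lemma extreme_subset_hull {I : finType} (v : I -> V) F :
  extreme_subset F (conv_hull v [set: I]%SET) ->
  exists A : {set I}, F = conv_hull v A.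
Proof.
move=> [sFS F_conv F_ext]; exists [set i | `[< F (v i) >]]%SET.
apply/seteqP; split; last first.
  by apply: conv_hull_min => // i; rewrite inE => /asboolP.
move=> x /[dup] Fx /sFS [w [w_ge0 w_sum def_x]].
have vertex_in i : 0 < w i -> F (v i).
  move=> wi_gt0.
  case: (conv_hull_split v w_ge0 w_sum (finset.in_setT i)); rewrite -def_x.
    by move=> <-.
  move=> [y hull_y [wi_lt1 xE]].
  apply: (F_ext _ y (w i)); rewrite -?xE ?wi_gt0 //.
    exists (fun j => (j == i)%:R); split.
    - by move=> j _; case: (j == i).
    - by rewrite (bigD1 i) ?inE //= eqxx big1 ?addr0 // => j /andP[_ /negPf->].
    - rewrite (bigD1 i) ?inE //= eqxx scale1r big1 ?addr0 // => j.
      by case/andP=> _ /negPf->; rewrite scale0r.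
  exact: conv_hullS hull_y.
rewrite def_x; apply: conv_hull_support => // i _.
rewrite inE => nFi; apply/eqP; rewrite eq_le w_ge0 ?inE // andbT leNgt.
by apply: contra nFi => /vertex_in ?; apply/asboolP.
Qed.

Lemma is_faceP k F S : is_simplex k S -> is_face F S <-> extreme_subset F S.
Proof.
move=> [v [v_free SE]]; split=> [[k' [v' [A [[v'_free ->] ->]]]]|].
  exact: conv_hull_extreme.
by rewrite SE => /extreme_subset_hull[A ->]; exists k, v, A.
Qed.

Lemma face_is_simplex F S : is_face F S -> exists k, is_simplex k F.
Proof.
move=> [k [v [A [[v_free SE] ->]]]].
exists #|A|, (v \o @enum_val _ A).
(* The coefficients [c] are extended by zero to all vertices of [S]; the sum
   over the fibre of [enum_val] has at most one term. *)
have ext (W : lmodType R) (f : 'I_k -> W) (c : 'I_#|A| -> R) :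
    \sum_i (\sum_(j | enum_val j == i) c j) *: f i
    = \sum_j c j *: f (enum_val j).
  under eq_bigr do rewrite scaler_suml big_mkcond.
  rewrite exchange_big /=; apply: eq_bigr => j _.
  rewrite (bigD1 (enum_val j)) //= eqxx big1 ?addr0 // => i.
  by rewrite eq_sym => /negPf ->.
have extE (c : 'I_#|A| -> R) j :
    \sum_(l | enum_val l == enum_val j) c l = c j.
  by rewrite (big_pred1 j) // => l; rewrite (inj_eq enum_val_inj).
split.
  move=> c c_sum c_pt j; rewrite -(extE c j).
  apply: (v_free (fun i => \sum_(l | enum_val l == i) c l)).
    have := ext R^o (fun _ => 1) c.
    under eq_bigr do rewrite [_ *: _]mulr1; move=> ->.
    by under eq_bigr do rewrite [_ *: _]mulr1.
  by rewrite ext.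
apply/seteqP; split=> x [w [w_ge0 w_sum ->]].
  exists (w \o enum_val); split.
  - by move=> j _; apply/w_ge0/enum_valP.
  - rewrite -w_sum [RHS]big_enum_val; apply: eq_bigl => i; exact: finset.in_setT.
  - rewrite [LHS]big_enum_val; apply: eq_bigl => i; by rewrite finset.in_setT.
pose u i := \sum_(l : 'I_#|A| | enum_val l == i) w l.
exists u; split.
- move=> i _; apply: sumr_ge0 => l _; apply: w_ge0; exact: finset.in_setT.
- rewrite -w_sum big_enum_val; apply: eq_big => j; first by rewrite finset.in_setT.
  by rewrite /u extE.
- rewrite [RHS]big_enum_val; apply: eq_big => j; first by rewrite finset.in_setT.
  by rewrite /u extE.
Qed.
End Faces.

(** * Permutations as rankings *)

Section Ranks.
Local Open Scope nat_scope.
Variable n : nat.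
Implicit Types (s t : 'S_n) (p q i : 'I_n).

Lemma card_perm_lt s p : #|[set q | s q < s p]%SET| = s p.
Proof.
have -> : [set q | s q < s p]%SET = (s @^-1: [set i : 'I_n | i < s p])%SET.
  by apply/setP => q; rewrite !inE.
rewrite card_preimset; last exact: perm_inj.
rewrite -[RHS]card_ord -sum1_card -sum1_card.
rewrite (eq_bigl (fun i : 'I_n => i < s p)); last by move=> i; rewrite inE.
by rewrite (big_ord_narrow (ltnW (ltn_ord (s p)))) sum1_card.
Qed.

Lemma perm_le_inj s t :
  (forall p q, t p <= t q -> s p <= s q) -> s = t.
Proof.
move=> s_mono; have s_lt p q : (t p < t q) = (s p < s q).
  apply/idP/idP=> [lt_t|]; last by rewrite !ltnNge; apply/contra/s_mono.
  rewrite ltn_neqAle s_mono ?(ltnW lt_t) // andbT.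
  by apply: contraTneq lt_t => /val_inj/perm_inj->; rewrite ltnn.
apply/permP => p; apply/val_inj; rewrite /= -(card_perm_lt s p) -(card_perm_lt t p).
by apply: eq_card => q; rewrite !inE s_lt.
Qed.

(** Sorting: position [p] receives as its letter the number of positions with a
    smaller key. *)
Lemma exists_perm_of_key (disp : Order.disp_t) (K : orderType disp)
    (key : 'I_n -> K) :
  injective key -> exists s : 'S_n, forall p q, (key p < key q)%O -> s p < s q.
Proof.
move=> key_inj; pose below p := [set q | (key q < key p)%O]%SET.
have rank_lt p : #|below p| < n.
  rewrite -[ltnRHS]card_ord -cardsT; apply: proper_card.
  rewrite properE finset.subsetT; apply/negP => /fintype.subsetP/(_ p).
  by rewrite !inE Order.POrderTheory.ltxx => /(_ isT).
pose rank p := Ordinal (rank_lt p).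
have rank_mono p q : (key p < key q)%O -> rank p < rank q.
  move=> lt_pq; apply: proper_card; apply/properP; split.
    apply/fintype.subsetP => r; rewrite !inE => lt_rp.
    exact: Order.POrderTheory.lt_trans lt_pq.
  by exists p; rewrite !inE ?Order.POrderTheory.ltxx.
have rank_inj : injective rank.
  move=> p q eq_rank; apply: key_inj; apply/eqP.
  by case: Order.TotalTheory.ltgtP => // /rank_mono; rewrite eq_rank ltnn.
by exists (perm rank_inj) => p q; rewrite !permE; apply: rank_mono.
Qed.

End Ranks.

(** * The simplices of the triangulation as order cones in the cube *)

Section ChainSimplices.
Local Open Scope classical_set_scope.
Local Open Scope ring_scope.
Import Order.TTheory GRing.Theory Num.Theory.
Variables (R : realType) (n : nat).
Local Notation V := 'rV[R]_n.
Implicit Types (s t : 'S_n) (p q : 'I_n) (x y : V).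

Lemma chain_vertexE s (i : 'I_n.+1) p :
  chain_vertex R s i 0 p = (i <= s p)%N%:R.
Proof.
rewrite !mxE summxE; under eq_bigr => k _.
  rewrite mxE eqxx /= -(inj_eq (@perm_inj _ s)) permKV eq_sym; over.
rewrite big_mkcond (bigD1 (s p)) //= eqxx big1 => [|k /negPf kp].
  by case: ltnP => _; rewrite addr0 ?subr0 ?subrr.
by rewrite kp; case: ifP.
Qed.

Lemma chain_combE s (w : 'I_n.+1 -> R) p :
  (\sum_i w i *: chain_vertex R s i) 0 p = \sum_(i < n.+1 | (i <= s p)%N) w i.
Proof.
rewrite summxE [RHS]big_mkcond; apply: eq_bigr => i _.
by rewrite mxE chain_vertexE; case: ifP; rewrite ?mulr1 ?mulr0.
Qed.

(** The coordinates of a combination are the partial sums of its coefficients,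
    taken in the order of the letters; if all partial sums vanish, so do the
    coefficients. *)
Lemma chain_vertex_free s : affinely_independent (chain_vertex R s).
Proof.
move=> c c_sum c_pt.
have partial0 m : (m < n.+1)%N -> \sum_(i < n.+1 | (i <= m)%N) c i = 0.
  rewrite ltnS leq_eqVlt => /predU1P[->|lt_mn].
    by rewrite -[RHS]c_sum; apply: eq_bigl => i; rewrite -ltnS ltn_ord.
  have := chain_combE s c (s^-1 (Ordinal lt_mn))%g.
  by rewrite permKV c_pt mxE.
move=> i; have := partial0 i (ltn_ord i); rewrite (bigD1 i) //=.
under eq_bigl => j.
  rewrite -(inj_eq val_inj) andbC -ltn_neqAle; over.
case: i => [[|m] lt_m] /=; first by rewrite big1 ?addr0.
by under eq_bigl do rewrite ltnS; rewrite partial0 ?addr0 // ltnW.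
Qed.

Lemma chain_simplex_is_simplex s : is_simplex n.+1 (chain_simplex R s).
Proof. by exists (chain_vertex R s); split=> //; exact: chain_vertex_free. Qed.

(** The barycentric coordinates of a point are the successive differences of
    its coordinates, sorted by letter and completed by 0 in front and 1 at the
    end; they are nonnegative exactly when the sorted sequence increases. *)
Lemma chain_simplexP s x : chain_simplex R s x <->
  (forall p, 0 <= x 0 p <= 1) /\
  (forall p q, (s p <= s q)%N -> x 0 p <= x 0 q).
Proof.
split.
  move=> [w [w_ge0 w_sum ->]]; rewrite (eq_bigl xpredT) => [|i]; last first.
    by rewrite finset.in_setT.
  have {}w_sum : \sum_i w i = 1.
    by rewrite -w_sum; apply: eq_bigl => i; rewrite finset.in_setT.
  have {}w_ge0 i : 0 <= w i by apply: w_ge0; rewrite finset.in_setT.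
  split=> [p|p q le_pq]; rewrite !chain_combE.
    rewrite sumr_ge0 //= -w_sum [leRHS](bigID (fun i : 'I__ => (i <= s p)%N)) /=.
    by rewrite lerDl sumr_ge0.
  rewrite [leRHS](bigID (fun i : 'I__ => (i <= s p)%N)) /=.
  rewrite [X in X + _](eq_bigl (fun i : 'I__ => (i <= s p)%N)).
    by rewrite lerDl sumr_ge0.
  by move=> i; rewrite andbC; case: leqP => // /leq_trans->.
move=> [x_cube x_mono].
(* [g] is the sorted sequence 0, x(s^-1 0), ..., x(s^-1 (n-1)), 1. *)
pose g k := if k is k'.+1 then oapp (fun i : 'I_n => x 0 (s^-1 i)%g) 1 (insub k')
            else 0.
have gE p : g (s p).+1 = x 0 p by rewrite /g valK /= permK.
have g_last : g n.+1 = 1 by rewrite /g insubN ?ltnn.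
pose w (i : 'I_n.+1) := g i.+1 - g i.
have w_sum m : (m <= n)%N -> \sum_(i < n.+1 | (i <= m)%N) w i = g m.+1.
  move=> le_mn; rewrite (big_ord_narrow_leq le_mn).
  rewrite -(big_mkord xpredT (fun i => g i.+1 - g i)).
  by rewrite telescope_sumr // subr0.
have w_ge0 i : 0 <= w i.
  rewrite subr_ge0; case: i => [[|m] /= lt_m].
    case: insubP => [i _ _|_] /=; rewrite ?ler01 //.
    by have /andP[] := x_cube (s^-1 i)%g.
  rewrite ltnS in lt_m; rewrite insubT /=.
  case: insubP => [i _ im|_] /=; last by have /andP[] := x_cube (s^-1 (Ordinal lt_m))%g.
  by apply: x_mono; rewrite !permKV im /=.
exists w; split.
- by move=> i _; apply: w_ge0.
- rewrite -g_last -w_sum //; apply: eq_bigl => i.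
  by rewrite finset.in_setT -ltnS ltn_ord.
- apply/rowP => p; rewrite (eq_bigl xpredT) => [|i]; last first.
    by rewrite finset.in_setT.
  by rewrite chain_combE w_sum ?gE // ltnW.
Qed.

(** The point whose coordinates are strictly increasing in the letters of [s]
    lies in no other simplex. *)
Lemma chain_simplex_inj s t :
  chain_simplex R s `<=` chain_simplex R t -> s = t.
Proof.
pose c : V := \row_p ((s p).+1%:R / n.+1%:R).
move=> /(_ c) sub; have /sub/chain_simplexP[_ c_mono] : chain_simplex R s c.
  apply/chain_simplexP; split=> [p|p q le_pq]; rewrite !mxE.
    rewrite divr_ge0 //= ler_pdivrMr ?ltr0Sn // mul1r ler_nat ltnS.
    exact: ltnW.
  by rewrite ler_pM2r ?invr_gt0 ?ltr0Sn // ler_nat ltnS.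
apply: perm_le_inj => p q /c_mono; rewrite !mxE.
by rewrite ler_pM2r ?invr_gt0 ?ltr0Sn // ler_nat ltnS.
Qed.
End ChainSimplices.

(** * The canonical triangulation *)

Section Triangulation.
Local Open Scope classical_set_scope.
Local Open Scope ring_scope.
Import Order.TTheory GRing.Theory Num.Theory.
Variables (R : realType) (n : nat).
Local Notation V := 'rV[R]_n.
Local Notation K := (canonical_triangulation R n).
Implicit Types (s t : 'S_n) (p q : 'I_n) (x y : V) (S T F : set V).

(** If [t] orders two positions against [s], then on the intersection both
    coordinates agree. As [s] orders the coordinates of both end points of a
    segment the same way, a vanishing difference at an inner point forces it
    to vanish at the end points. *)
Lemma chain_simplexI_extreme s t :
  extreme_subset (chain_simplex R s `&` chain_simplex R t) (chain_simplex R s).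
Proof.
split=> [x []//|x y r [sx tx] [sy ty] r01|x y r sx sy /andP[r0 r1] [_ tz]].
  by split; apply: conv_hull_convex.
split=> //; move/chain_simplexP: sx => [x_cube sx].
move/chain_simplexP: sy => [_ sy]; move/chain_simplexP: tz => [_ tz].
apply/chain_simplexP; split=> // p q /tz; rewrite !mxE.
case: (leqP (s p) (s q)) => [/sx //|/ltnW le_qp].
have := sx _ _ le_qp; have := sy _ _ le_qp; nra.
Qed.

Lemma chain_faceP s F :
  is_face F (chain_simplex R s) <-> extreme_subset F (chain_simplex R s).
Proof. exact: (is_faceP _ (chain_simplex_is_simplex R s)). Qed.

Lemma canonical_chain s : alternating s -> K (chain_simplex R s).
Proof.
move=> s_alt; exists s => //; apply/chain_faceP; split=> //.
by move=> x y r *; apply: conv_hull_convex.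
Qed.

Lemma canonical_simplicial : simplicial_complex K.
Proof.
split.
- by move=> S [s _ /face_is_simplex].
- move=> S F [s s_alt sS] FS; exists s => //.
  have [k S_simplex] := face_is_simplex sS.
  apply/chain_faceP/(extreme_subset_trans (S := S)); last exact/chain_faceP.
  exact/(is_faceP _ S_simplex).
- suff face_l S T : K S -> K T -> is_face (S `&` T) S.
    by move=> S T KS KT; split; [|rewrite setIC]; apply: face_l.
  move=> [s _ sS] [t _ tT]; have [k S_simplex] := face_is_simplex sS.
  apply/(is_faceP _ S_simplex).
  move/chain_faceP: sS => sS; move/chain_faceP: tT => tT.
  exact: extreme_subsetI sS tT (chain_simplexI_extreme s t).
Qed.

Lemma alternating_zigzag s p q :
  alternating s -> zigzag_lt p q -> (s p < s q)%N.
Proof.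
move=> /forallP s_alt /andP[p_even /orP[] /eqP pq].
  have /forallP/(_ q)/implyP := s_alt p.
  by rewrite pq eqxx (negPf p_even) => /(_ isT).
have /forallP/(_ p)/implyP := s_alt q; rewrite pq eqxx.
by move: p_even; rewrite pq /= negbK => -> /(_ isT).
Qed.

(** A point [x] of the order polytope lies in the simplex of the permutation
    sorting its coordinates. Ties are broken in favour of the even positions,
    which are the minimal elements of the poset, so that the permutation is
    alternating; the index breaks the remaining ties. *)
Lemma canonical_cover : \bigcup_(S in K) S = order_polytope R (@zigzag_lt n).
Proof.
apply/seteqP; split=> [x [S [s s_alt]]|x [x_cube x_mono]].
  move=> /chain_faceP[sSs _ _] /sSs/chain_simplexP[x_cube x_mono].
  split=> // p q /(alternating_zigzag s_alt)/ltnW; exact: x_mono.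
pose key p : R *l (bool *l 'I_n) := (x 0 p, (odd p, p)).
have key_inj : injective key by move=> p q [].
have [s s_key] := exists_perm_of_key key_inj.
have s_x p q : (s p <= s q)%N -> x 0 p <= x 0 q.
  rewrite leqNgt leNgt; apply: contra => lt_qp.
  by apply: s_key; rewrite /key ltxi_pair (ltW lt_qp) leNgt lt_qp.
have s_zigzag p q : zigzag_lt p q -> (s p < s q)%N.
  move=> /[dup] /x_mono le_pq /andP[p_even pq]; apply: s_key.
  rewrite /key ltxi_pair le_pq /=; apply/implyP => _.
  rewrite ltxi_pair (negPf p_even); suff -> : odd q by [].
  by case/orP: pq => /eqP pq; move: p_even; rewrite pq //= => /negPn.
exists (chain_simplex R s).
  apply: canonical_chain; apply/forallP => p; apply/forallP => q.
  apply/implyP => pq; case: ifPn => p_odd; apply: s_zigzag; rewrite /zigzag_lt.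
    by rewrite (eqP pq) /= p_odd /= eqxx orbT.
  by rewrite p_odd pq.
exact/chain_simplexP.
Qed.

Lemma maximal_canonical S :
  maximal_simplex K S <-> exists2 s, alternating s & S = chain_simplex R s.
Proof.
split=> [[[s s_alt /chain_faceP[sSs _ _]] S_max]|[s s_alt ->]].
  by exists s => //; rewrite (S_max _ _ sSs) //; apply: canonical_chain.
split=> [|T [t t_alt /chain_faceP[sTt _ _]] sST]; first exact: canonical_chain.
apply/seteqP; split=> //.
by rewrite (@chain_simplex_inj R n s t (subset_trans sST sTt)).
Qed.

End Triangulation.

(** * Swapping consecutive letters *)

Section Shelling.
Local Open Scope nat_scope.
Variable n : nat.
Implicit Types (s t : 'S_n) (p q : 'I_n).

Definition inversions s : {set 'I_n * 'I_n} :=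
  [set p : 'I_n * 'I_n | (p.1 < p.2) && (s p.2 < s p.1)]%SET.

Lemma inversions_inj : injective inversions.
Proof.
move=> s t /setP eq_inv; apply: perm_le_inj => p q.
have := eq_inv (p, q); have := eq_inv (q, p); rewrite !inE /= => e1 e2.
case: (ltngtP p q) e1 e2 => [||/val_inj-> //] /= lt_pq e1 e2.
  by rewrite leqNgt -e2 -leqNgt.
rewrite leq_eqVlt -e1 => /predU1P[/val_inj/perm_inj eq_pq|/ltnW//].
by rewrite eq_pq ltnn in lt_pq.
Qed.

(** A permutation is determined by its inversions, so [t] cannot have its
    inversions among those of [s] without having fewer of them. *)
Lemma exists_new_inversion s t :
  s <> t -> inv_number s <= inv_number t ->
  exists p q, [/\ p < q, s p < s q & t q < t p].
Proof.
move=> neq_st le_inv; have [sub|] := boolP (inversions t \subset inversions s).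
  case: neq_st; apply: inversions_inj; apply/esym/eqP.
  by rewrite eqEcard sub.
case/fintype.subsetPn=> -[p q]; rewrite !inE /= => /andP[lt_pq lt_t].
rewrite lt_pq -leqNgt => le_s; exists p, q; split=> //.
rewrite ltn_neqAle le_s andbT; apply: contraTneq lt_pq.
by move=> /val_inj/perm_inj->; rewrite ltnn.
Qed.

Lemma alternating_next s p q : alternating s -> q = p.+1 :> nat ->
  (s p < s q) = ~~ odd p.
Proof.
move=> /forallP/(_ p)/forallP/(_ q)/implyP s_alt pq.
by move/eqP/s_alt: pq; case: ifP => // _ /ltnW; rewrite leqNgt => /negPf.
Qed.

(** Follow the positions of the letters from [s p] to [s q]. If no step went
    right by more than one position, each step would go left, or one to the
    right; the latter only from an even position (a valley) to the odd
    position after it (a peak), so never twice in a row. Such a walk starting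
    at [p] cannot get beyond [p.+1], hence cannot reach [q]. *)
Lemma exists_swappable s p q : alternating s ->
  p.+1 < q -> s p < s q ->
  exists a b, [/\ s b = (s a).+1 :> nat, s p <= s a, s b <= s q & a.+1 < b].
Proof.
move=> s_alt lt_pq lt_s; apply: contrapT => no_step.
suff bound m (lt_mn : m < n) : s p <= m <= s q ->
    let c := (s^-1 (Ordinal lt_mn))%g in c <= p \/ (c = p.+1 :> nat /\ ~~ odd p).
  have /= := bound (s q) (ltn_ord (s q)); rewrite leqnn (ltnW lt_s) => /(_ isT).
  have -> : Ordinal (ltn_ord (s q)) = s q by apply: val_inj.
  by rewrite permK; lia.
elim: m lt_mn => [|m IHm] lt_mn /andP[le_pm le_mq] /=.
  left; suff -> : (s^-1 (Ordinal lt_mn))%g = p by [].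
  apply: (canLR (permK s)); apply: val_inj => /=; lia.
have [eq_pm|neq_pm] := eqVneq (s p : nat) m.+1.
  left; suff -> : (s^-1 (Ordinal lt_mn))%g = p by [].
  by apply: (canLR (permK s)); apply: val_inj.
have := IHm (ltnW lt_mn); set b := (s^-1 (Ordinal lt_mn))%g.
set a := (s^-1 _)%g => /= bound_a.
have sa : s a = m :> nat by rewrite permKV.
have sb : s b = m.+1 :> nat by rewrite permKV.
have {}bound_a : a <= p \/ a = p.+1 :> nat /\ ~~ odd p by apply: bound_a; lia.
have le_ba : b <= a.+1.
  rewrite leqNgt; apply/negP => lt_ab; apply: no_step; exists a, b.
  by split=> //; lia.
have neq_ba : b <> a :> nat.
  by move=> /val_inj eq_ba; move: sb; rewrite eq_ba sa; lia.
have [ba|lt_ba] : b = a.+1 :> nat \/ b < a by lia.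
  have := alternating_next s_alt ba; rewrite sa sb ltnSn => /esym a_even.
  by case: bound_a => [|[]]; case: (eqVneq (a : nat) p) => [<-|]; lia.
lia.
Qed.

Lemma tperm_succ_lt (a b c d : 'I_n) : b = a.+1 :> nat -> (c, d) <> (a, b) ->
  c < d -> tperm a b c < tperm a b d.
Proof.
move=> ab neq_cd lt_cd.
have {neq_cd} neq_cd : c <> a :> nat \/ d <> b :> nat.
  have [ca|/eqP ca] := eqVneq c a; last by left=> /val_inj.
  by right=> /val_inj db; apply: neq_cd; rewrite ca db.
by rewrite !permE /= -!(inj_eq val_inj) /=; do 4?case: eqP => /=; lia.
Qed.

(** The letters of two positions [a], [b] that are not adjacent can be exchanged
    without spoiling the alternation, and as they are consecutive letters,
    only the relative order of [a] and [b] changes. *)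
Section Swap.
Variables (s : 'S_n) (a b : 'I_n).
Hypotheses (sab : s b = (s a).+1 :> nat) (lt_ab : a.+1 < b).
Local Notation s' := (s * tperm (s a) (s b))%g.

Lemma swap_lt p q : (p, q) <> (a, b) -> s p < s q -> s' p < s' q.
Proof.
move=> neq_pq lt_s; rewrite !permM; apply: tperm_succ_lt => //.
by case=> /perm_inj pa /perm_inj qb; rewrite pa qb in neq_pq.
Qed.

Lemma alternating_swap : alternating s -> alternating s'.
Proof.
move=> s_alt; apply/forallP => p; apply/forallP => q; apply/implyP => pq.
move: s_alt => /forallP/(_ p)/forallP/(_ q)/implyP/(_ pq).
move/eqP: pq => pq; case: ifP => _; apply: swap_lt => -[ea eb];
  by move: pq lt_ab; rewrite ea eb; lia.
Qed.

Lemma inv_number_swap : inv_number s < inv_number s'.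
Proof.
apply: proper_card; apply/properP; split.
  apply/fintype.subsetP => -[p q]; rewrite !inE /= => /andP[lt_pq lt_s].
  rewrite lt_pq swap_lt // => -[eq_q eq_p].
  by move: lt_pq lt_ab; rewrite eq_q eq_p; lia.
exists (a, b); rewrite !inE /=; last by rewrite sab; lia.
by rewrite !permM tpermL tpermR sab; lia.
Qed.

End Swap.

Local Open Scope classical_set_scope.
Local Open Scope ring_scope.
Import Order.TTheory GRing.Theory Num.Theory.

(** Exchanging the consecutive letters of [a] and [b] changes only the
    inequality between these two coordinates, and reverses it. *)
Lemma swap_simplexI (R : realType) s a b : s b = (s a).+1 :> nat ->
  chain_simplex R (s * tperm (s a) (s b))%g `&` chain_simplex R s
  = [set x | chain_simplex R s x /\ x 0 a = x 0 b].
Proof.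
move=> sab; apply/seteqP; split=> x /=.
  move=> [/chain_simplexP[_ s'x] sx]; split=> //.
  move/chain_simplexP: sx => [_ sx].
  apply/eqP; rewrite eq_le sx ?sab ?leqnSn //=; apply: s'x.
  by rewrite !permM tpermL tpermR sab leqnSn.
move=> [sx xab]; split=> //; move/chain_simplexP: sx => [x_cube sx].
apply/chain_simplexP; split=> // p q.
have [/sx //|lt_qp] := leqP (s p) (s q).
have [[-> ->]|neq] : q = a /\ p = b \/ (q, p) <> (a, b).
- by have [[-> ->]|] := eqVneq (q, p) (a, b); [left|right; apply/eqP].
- by rewrite xab.
by rewrite leqNgt swap_lt.
Qed.

(** The difference of the two coordinates is the barycentric coordinate of the
    vertex numbered [s b], which therefore is the one left out. *)
Lemma swap_facet (R : realType) s a b : s b = (s a).+1 :> nat ->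
  is_facet [set x | chain_simplex R s x /\ x 0 a = x 0 b] (chain_simplex R s).
Proof.
move=> sab; exists n.+1, (chain_vertex R s), (widen_ord (leqnSn n) (s b)).
split; first by split=> //; exact: chain_vertex_free.
set j := widen_ord _ _.
have stepE (w : 'I_n.+1 -> R) : let x := \sum_i w i *: chain_vertex R s i in
    x 0 b = w j + x 0 a.
  rewrite /= !chain_combE (bigD1 j) //=; congr (_ + _); apply: eq_bigl => i.
  by rewrite -(inj_eq val_inj) /= sab andbC -ltn_neqAle ltnS.
apply/seteqP; split=> x /=.
  move=> [[w [w_ge0 w_sum ->]] eq_ab].
  apply: conv_hull_support => // i _.
  rewrite !inE negbK => /eqP->; move: eq_ab.
  rewrite (eq_bigl xpredT) => [|k]; last by rewrite finset.in_setT.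
  by rewrite stepE => /eqP; rewrite -subr_eq0 opprD addrCA subrr addr0 oppr_eq0 => /eqP.
move=> jx; split; first exact: conv_hullS (finset.subsetT _) x jx.
case: jx => w [w_ge0 w_sum ->].
pose u i := if i == j then 0 else w i.
have -> : \sum_(i in [set~ j]%SET) w i *: chain_vertex R s i
    = \sum_i u i *: chain_vertex R s i.
  rewrite big_mkcond; apply: eq_bigr => i _; rewrite !inE /u.
  by case: (i == j); rewrite ?scale0r.
by rewrite stepE /u eqxx add0r.
Qed.

(** The combinatorial core. Let [p < q] be an inversion of [t] but not of [s].
    On the intersection of the simplices, x_p <= x_q by [s] and x_q <= x_p by
    [t], so all coordinates whose letter in [s] is between [s p] and [s q]
    coincide, and any exchangeable pair found there gives a facet that
    contains the intersection. *)
Lemma exists_shelling_facet (R : realType) s t :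
    alternating s -> alternating t -> s <> t ->
    (inv_number s <= inv_number t)%N ->
  exists s', [/\ alternating s', (inv_number s < inv_number s')%N,
    is_facet (chain_simplex R s' `&` chain_simplex R s) (chain_simplex R s)
    & chain_simplex R t `&` chain_simplex R s
        `<=` chain_simplex R s' `&` chain_simplex R s].
Proof.
move=> s_alt t_alt neq_st le_inv.
have [p [q [lt_pq lt_s lt_t]]] := exists_new_inversion neq_st le_inv.
(* Adjacent positions are ordered alike by all alternating permutations. *)
have lt_pq1 : (p.+1 < q)%N.
  rewrite ltn_neqAle lt_pq andbT; apply/eqP => /esym pq; move: lt_s lt_t.
  rewrite (alternating_next s_alt pq) -(alternating_next t_alt pq).
  by move=> /ltn_trans lt /lt; rewrite ltnn.
have [a [b [sab le_pa le_bq lt_ab]]] :=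
  exists_swappable s_alt lt_pq1 lt_s.
exists (s * tperm (s a) (s b))%g; split.
- exact: alternating_swap.
- exact: inv_number_swap.
- by rewrite swap_simplexI //; apply: swap_facet.
rewrite swap_simplexI // => x [/chain_simplexP[_ tx] /[dup] sx].
move=> /chain_simplexP[_ s_mono]; split=> //; apply/eqP.
rewrite eq_le s_mono ?sab ?leqnSn //=.
apply: le_trans (s_mono _ _ le_bq) _.
by apply: le_trans (tx _ _ (ltnW lt_t)) _; apply: s_mono.
Qed.

End Shelling.

(** * Shelling by decreasing inversion number *)

Theorem theorem2p3 (R : realType) (n : nat) (n_ge1 : (1 <= n)%N)
    (sigma : 'I_(num_alternating n) -> 'S_n)
    (sigma_inj : injective sigma)
    (sigma_alt : forall tau : 'S_n,
       alternating tau <-> exists i, sigma i = tau)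
    (sigma_inv : forall i j : 'I_(num_alternating n), (i < j)%N ->
       (inv_number (sigma j) <= inv_number (sigma i))%N) :
  triangulates (canonical_triangulation R n) (order_polytope R (@zigzag_lt n))
  /\ shelling_order (canonical_triangulation R n)
       (fun i => chain_simplex R (sigma i)).
Proof.
have alt i : alternating (sigma i) by apply/sigma_alt; exists i.
split; first by split; [exact: canonical_simplicial | exact: canonical_cover].
split.
- exact: canonical_simplicial.
- exists n.+1 => S /maximal_canonical[s _ ->].
  exact: chain_simplex_is_simplex.
- move=> i j eq_ij; apply: sigma_inj; apply: (@chain_simplex_inj R).
  by rewrite eq_ij.
- apply/seteqP; split=> [_ [i _ <-]|S /maximal_canonical[s /sigma_alt[i <-] ->]].
    by apply/maximal_canonical; exists (sigma i).
  by exists i.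
move=> r r_gt0.
pose D i := chain_simplex R (sigma i).
have earlier_facet (k : 'I_(num_alternating n)) : (k < r)%N ->
    exists i : 'I_(num_alternating n),
    [/\ (i < r)%N, is_facet (D i `&` D r)%classic (D r)
      & (D k `&` D r `<=` D i `&` D r)%classic].
  move=> lt_kr; have neq_rk : sigma r <> sigma k.
    by move=> /sigma_inj rk; rewrite rk ltnn in lt_kr.
  have [_ [/sigma_alt[i <-] lt_inv facet sub]] := exists_shelling_facet R
    (alt r) (alt k) neq_rk (sigma_inv _ _ lt_kr).
  exists i; split=> //; rewrite ltnNge leq_eqVlt; apply/negP.
  move=> /predU1P[/val_inj ri|/sigma_inv].
    by rewrite ri ltnn in lt_inv.
  by rewrite leqNgt lt_inv.
(* The facets used are all those cut out on D r by an earlier simplex. *)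
exists [set F | is_facet F (D r) /\
  exists2 i : 'I_(num_alternating n), (i < r)%N & F = D i `&` D r]%classic.
split.
- have [i [lt_ir facet _]] := earlier_facet (Ordinal (ltn_trans r_gt0 (ltn_ord r))) r_gt0.
  by exists (D i `&` D r)%classic; split=> //; exists i.
- by move=> F [].
apply/seteqP; split=> x.
  move=> [k lt_kr Dkx]; have [i [lt_ir facet sub]] := earlier_facet k lt_kr.
  by exists (D i `&` D r)%classic; [split=> //; exists i | exact: sub].
by move=> [F [_ [i lt_ir ->]] Dx]; exists i.
Qed.
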